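(* For $\bm z\in\mathrm{Bool}(\mathcal Z)$ let $$f(\bm z)=\max_{\bm\alpha\in\mathbb R^n}\ h(\bm\alpha)-\sum_{i=1}^n z_i\,\Omega^\star(\alpha_i),$$ and let $\bm\alpha^\star(\bm z)$ denote an optimal solution of this maximization problem. Then for any $\bm z,\bm z'\in\mathrm{Bool}(\mathcal Z)$: (a) with big-$M$ regularization, i.e. $\Omega^\star(\beta)=M|\beta|$, $$f(\bm z')-f(\bm z)\le M\sum_{i=1}^n (z_i-z_i')\,|\alpha^\star(\bm z')_i|;$$ (b) with ridge regularization, i.e. $\Omega^\star(\beta)=\frac{\gamma}{2}\beta^2$, $$f(\bm z')-f(\bm z)\le \frac{\gamma}{2}\sum_{i=1}^n (z_i-z_i')\,\alpha^\star(\bm z')_i^2.$$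
   Context: Setting: $n\ge1$; $\mathcal Z\subseteq\{0,1\}^n$ is a set of binary vectors described by integrality together with further constraints, i.e. $\mathcal Z=P\cap\{0,1\}^n$, and $\mathrm{Bool}(\mathcal Z)=P\cap[0,1]^n$ is the convex set obtained by relaxing $\bm z\in\{0,1\}^n$ to $\bm z\in[0,1]^n$ in the definition of $\mathcal Z$. $g:\mathbb R^n\to\mathbb R\cup\{+\infty\}$ is a convex function and $h(\bm\alpha):=\inf_{\bm v\in\mathbb R^n} g(\bm v)-\bm v^\top\bm\alpha$. $M>0$ and $\gamma>0$ are fixed regularization parameters. An optimal solution $\bm\alpha^\star(\bm z')$ is a point attaining the maximum defining $f(\bm z')$, with finite optimal value; the inequality holds for any such choice. *)

(* Defs.v *)
From mathcomp Require Import all_boot all_order all_algebra.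
From mathcomp Require Import all_classical all_reals all_analysis.

Set Implicit Arguments.
Unset Strict Implicit.
Unset Printing Implicit Defensive.

Import Order.TTheory GRing.Theory Num.Theory.

Local Open Scope classical_set_scope.
Local Open Scope ring_scope.

Definition binary_vectors (R : realType) (n : nat) : set 'cV[R]_n :=
  [set z | forall i, z i 0 = 0 \/ z i 0 = 1].

Definition unit_cube (R : realType) (n : nat) : set 'cV[R]_n :=
  [set z | forall i, 0 <= z i 0 <= 1].

(* [Z = P `&` {0,1}^n]; its relaxation depends on the description [P],
   not only on the set [Z], so both are functions of [P]. *)
Definition binary_set (R : realType) (n : nat) (P : set 'cV[R]_n)
    : set 'cV[R]_n := P `&` @binary_vectors R n.

Definition Bool_relax (R : realType) (n : nat) (P : set 'cV[R]_n)
    : set 'cV[R]_n := P `&` @unit_cube R n.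

Definition never_ninfty (R : realType) (T : Type) (g : T -> \bar R) : Prop :=
  forall v, g v != -oo%E.

(* [convex_function] of the library is restricted to real-valued functions.
   Here [g] takes values in R ∪ {+oo}; with the convention [0 * +oo = 0] the
   inequality is trivial at the endpoints t = 0 and t = 1. *)
Definition econvex_function (R : realType) (n : nat)
    (g : 'cV[R]_n -> \bar R) : Prop :=
  forall (x y : 'cV[R]_n) (t : R), 0 <= t <= 1 ->
    (g ((t *: x + (1 - t) *: y)%R) <= t%:E * g x + (1 - t)%:E * g y)%E.

Definition dotv (R : realType) (n : nat) (v a : 'cV[R]_n) : R :=
  (v^T *m a) 0 0.

Definition h_conj (R : realType) (n : nat) (g : 'cV[R]_n -> \bar R)
    (a : 'cV[R]_n) : \bar R :=
  ereal_inf (range (fun v : 'cV[R]_n => g v - (dotv v a)%:E)%E).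

Definition bigM_conj (R : realType) (M : R) (b : R) : R := M * `|b|.

Definition ridge_conj (R : realType) (gamma : R) (b : R) : R :=
  gamma / 2 * b ^+ 2.

Definition objective (R : realType) (n : nat) (g : 'cV[R]_n -> \bar R)
    (Omega : R -> R) (z a : 'cV[R]_n) : \bar R :=
  (h_conj g a - (\sum_(i < n) z i 0 * Omega (a i 0))%R%:E)%E.

(* Supremum in the extended reals; it is the maximum as soon as an
   [optimal_solution] exists. *)
Definition opt_value (R : realType) (n : nat) (g : 'cV[R]_n -> \bar R)
    (Omega : R -> R) (z : 'cV[R]_n) : \bar R :=
  ereal_sup (range (objective g Omega z)).

Definition optimal_solution (R : realType) (n : nat) (g : 'cV[R]_n -> \bar R)
    (Omega : R -> R) (z a : 'cV[R]_n) : Prop :=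
  opt_value g Omega z \is a fin_num /\
  forall b, (objective g Omega z b <= objective g Omega z a)%E.

(* Main.v *)
Require Import Defs.
From mathcomp Require Import all_boot all_order all_algebra.
From mathcomp Require Import all_classical all_reals all_analysis.
From mathcomp Require Import lra.

Set Implicit Arguments.
Unset Strict Implicit.
Unset Printing Implicit Defensive.

Import Order.TTheory GRing.Theory Num.Theory.

Local Open Scope classical_set_scope.
Local Open Scope ring_scope.

(** Subgradient inequality: [opt_value] is a supremum over [a] of functions affine in [z]. Freezing
    [a] at the maximizer [a'] for [z'] gives an affine minorant that touches at [z'] and has slope
    [- Omega (a' i 0)] in coordinate [i]. The argument works for any [Omega]; big-M and ridge are
    two instances. *)

(* The maximizer at [z'] is a feasible candidate at [z], and the two objectives
   at that point differ only in their term linear in [z]. *)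
Lemma opt_value_sub_le (R : realType) (n : nat) (g : 'cV[R]_n -> \bar R)
    (Omega : R -> R) (z z' a' : 'cV[R]_n) :
  optimal_solution g Omega z' a' ->
  (opt_value g Omega z' - opt_value g Omega z
   <= (\sum_(i < n) (z i 0 - z' i 0) * Omega (a' i 0))%R%:E)%E.
Proof.
move=> [fin_opt a'_max].
have optE : opt_value g Omega z' = objective g Omega z' a'.
  apply/eqP; rewrite eq_le; apply/andP; split.
    by apply: ge_ereal_sup => _ [b _ <-].
  by apply: ereal_sup_ubound; exists a'.
have opt_ge : (objective g Omega z a' <= opt_value g Omega z)%E.
  by apply: ereal_sup_ubound; exists a'.
under eq_bigr do rewrite mulrBl.
rewrite sumrB; move: fin_opt opt_ge; rewrite optE /objective.
(* Finiteness of the optimal value at [z'] forces [h_conj g a'] to be a real [r], so it cancels in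
   the difference. *)
case: (h_conj g a') => [r| |] //= _.
(* The value at [z] may be [+oo], and then the left side is [-oo]; [-oo] is excluded by [opt_ge]. *)
case: (opt_value g Omega z) => [s| |] //=; last by rewrite leNye.
by rewrite -!EFinB !lee_fin => opt_ge; lra.
Qed.

Theorem proposition2p9 (R : realType) (n : nat) (n_ge1 : (1 <= n)%N)
    (P Z : set 'cV[R]_n) (ZE : Z = binary_set P)
    (convex_Bool : convex_set (Bool_relax P : set (convex_lmodType 'cV[R]_n)))
    (g : 'cV[R]_n -> \bar R) (g_gtNy : never_ninfty g)
    (g_convex : econvex_function g)
    (M gamma : R) (M_gt0 : 0 < M) (gamma_gt0 : 0 < gamma) :
  (forall z z' : 'cV[R]_n, Bool_relax P z -> Bool_relax P z' ->
     forall a' : 'cV[R]_n, optimal_solution g (bigM_conj M) z' a' ->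
     (opt_value g (bigM_conj M) z' - opt_value g (bigM_conj M) z
      <= (M * \sum_(i < n) (z i 0 - z' i 0) * `|a' i 0|)%R%:E)%E)
  /\
  (forall z z' : 'cV[R]_n, Bool_relax P z -> Bool_relax P z' ->
     forall a' : 'cV[R]_n, optimal_solution g (ridge_conj gamma) z' a' ->
     (opt_value g (ridge_conj gamma) z' - opt_value g (ridge_conj gamma) z
      <= (gamma / 2 * \sum_(i < n) (z i 0 - z' i 0) * a' i 0 ^+ 2)%R%:E)%E).
Proof.
(* It remains to move the constant [M] or [gamma / 2] through the sum. *)
split=> z z' _ _ a' /(opt_value_sub_le z) /le_trans; apply;
  by rewrite mulr_sumr; under eq_bigr do rewrite mulrCA.
Qed.
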